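(* Let $\Theta$ be a finite set with $|\Theta|\ge 3$. Let $C$ be a Csiszár information cost generated by a transformation $\phi$ that is essentially smooth and is thrice continuously differentiable with $\phi''>0$ on $(0,+\infty)$. The following statements are equivalent: (i) For every decision problem $\mathcal D=(\pi,A)$, there exists some posterior-separable cost that generates the same set of optimal stochastic choice rules in $\mathcal D$ as $C$. (ii) $C$ is proportional to mutual information: there exists $\kappa>0$ such that $C=\kappa I_S$.
   Context: A decision problem is a pair $(\pi,A)$ where $\pi\in\Delta(\Theta)$ is a full-support prior and $A\subset\mathbb{R}^\Theta$ is a finite nonempty set of actions ($a(\theta)$ is the utility of $a$ in state $\theta$). An experiment is $P=(S,(P_\theta)_{\theta\in\Theta})$ with $S$ a finite set and $P_\theta\in\Delta(S)$; $P_\pi=\sum_\theta\pi(\theta)P_\theta$. A stochastic choice rule is an experiment with $S=A$. Given a cost $C(P,\pi)\in[0,+\infty]$, a stochastic choice rule is optimal in $(\pi,A)$ if it maximizes $\sum_\theta\pi(\theta)\sum_{a\in A}P_\theta(a)a(\theta)-C(P,\pi)$ over $P\in\Delta(A)^\Theta$. Csiszár information: a transformation is a convex, lower semicontinuous function $\phi:\mathbb{R}_+\to[0,+\infty]$ with $\phi(1)=0$ which (standing assumption) is superlinear at infinity ($\phi(t)/t\to+\infty$ as $t\to+\infty$), strictly convex on $\operatorname{int}(\operatorname{dom}\phi)$, and satisfies $1\in\operatorname{int}(\operatorname{dom}\phi)$. It generates the cost, for every full-support prior $\pi$ and experiment $P$, $$C(P,\pi)=\min_{\alpha\in\Delta(S)}\sum_{\theta\in\Theta}\pi(\theta)\sum_{s\in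 S}\alpha(s)\phi\Big(\frac{P_\theta(s)}{\alpha(s)}\Big),$$ where $0\cdot\phi(x/0)=\lim_{t\to+\infty}\phi(1+tx)/t$ for $x\ge0$. $\phi$ is essentially smooth if it is finite and differentiable on $(0,+\infty)$ and $\lim_{t\to0}\phi'(t)=-\infty$. Posterior-separable cost: generated by a family $(H_\pi)$ indexed by full-support priors, where each $H_\pi:\Delta(\Theta)\to[0,+\infty]$ is convex and lower semicontinuous with $H_\pi(\pi)=0$, and (standing assumption) $H_\pi$ is strictly convex on $\operatorname{dom}H_\pi$ and $\pi$ is in the relative interior of $\operatorname{dom}H_\pi$. The cost is $\sum_{s\in\operatorname{supp}P_\pi}P_\pi(s)H_\pi(p_s)$, where $p_s(\theta)=\pi(\theta)P_\theta(s)/P_\pi(s)$ is the Bayesian posterior. Mutual information: $I_S(P,\pi)=\sum_\theta\pi(\theta)D_{\mathrm{KL}}(P_\theta\Vert P_\pi)$, with $D_{\mathrm{KL}}(\beta\Vert\alpha)=\sum_s\beta(s)\log(\beta(s)/\alpha(s))$. *)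

(* Defs.v *)
(* MathComp-Analysis. *)
From HB Require Import structures.
From mathcomp Require Import all_boot all_order all_algebra finmap.
From mathcomp Require Import all_classical all_reals all_analysis.

Set Implicit Arguments.
Unset Strict Implicit.
Unset Printing Implicit Defensive.

Import Order.TTheory GRing.Theory Num.Theory.
Import numFieldNormedType.Exports.

Local Open Scope classical_set_scope.
Local Open Scope ring_scope.

(* For the nonnegative functions considered below, the convention
   0 * +oo = 0 makes the inequality correct for t = 0 and t = 1. *)
Definition econvex_on (R : realType) (E : lmodType R) (D : set E)
    (f : E -> \bar R) : Prop :=
  forall (x y : E) (t : R), D x -> D y -> 0 <= t <= 1 ->
    (f (t *: x + (1 - t) *: y)%R <= t%:E * f x + (1 - t)%R%:E * f y)%E.

Definition strictly_econvex_on (R : realType) (E : lmodType R) (D : set E)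
    (f : E -> \bar R) : Prop :=
  forall (x y : E) (t : R), D x -> D y -> x <> y -> 0 < t < 1 ->
    (f (t *: x + (1 - t) *: y)%R < t%:E * f x + (1 - t)%R%:E * f y)%E.

(* Effective domain of a function whose mathematical domain is D; its values
   outside D are irrelevant. *)
Definition dom_on (R : realType) (E : Type) (D : set E) (f : E -> \bar R)
  : set E := [set x | D x /\ (f x < +oo)%E].

(* Lower semicontinuity on D, for the topology that D inherits from E. *)
Definition lsc_on (R : realType) (E : topologicalType) (D : set E)
    (f : E -> \bar R) : Prop :=
  lower_semicontinuous (f : subspace D -> \bar R).

Definition affine_hull (R : realType) (E : lmodType R) (C : set E) : set E :=
  [set x | exists (n : nat) (w : 'I_n -> R) (y : 'I_n -> E),
    [/\ forall i, C (y i), \sum_i w i = 1 & x = \sum_i w i *: y i]].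

(* R^T carries the product topology, which for finite T is the Euclidean
   one. *)
Definition relative_interior (R : realType) (T : finType) (C : set (T -> R))
  : set (T -> R) :=
  [set x | C x /\
    \forall y \near nbhs (x : {ptws T -> R}), affine_hull C y -> C y].

Definition simplex (R : realType) (T : finType) : set (T -> R) :=
  [set p | (forall x, 0 <= p x) /\ \sum_x p x = 1].

Definition full_support_prior (R : realType) (Theta : finType)
    (pi : Theta -> R) : Prop :=
  simplex pi /\ forall theta, 0 < pi theta.

Definition experiment (R : realType) (Theta S : finType)
    (P : Theta -> S -> R) : Prop :=
  forall theta, simplex (P theta).

Definition marginal (R : realType) (Theta S : finType)
    (P : Theta -> S -> R) (pi : Theta -> R) : S -> R :=
  fun s => \sum_theta pi theta * P theta s.

Definition posterior (R : realType) (Theta S : finType)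
    (P : Theta -> S -> R) (pi : Theta -> R) (s : S) : Theta -> R :=
  fun theta => pi theta * P theta s / marginal P pi s.

(* Only the values of a cost at experiments and full-support priors are
   meaningful. *)
Definition cost (R : realType) (Theta : finType) : Type :=
  forall S : finType, (Theta -> S -> R) -> (Theta -> R) -> \bar R.

(* A finite set of actions A is itself used as a finite type of signals. *)
Definition net_payoff (R : realType) (Theta : finType) (C : cost R Theta)
    (pi : Theta -> R) (A : {fset {ffun Theta -> R}}) (P : Theta -> A -> R)
  : \bar R :=
  ((\sum_theta pi theta * \sum_(a : A) P theta a * val a theta)%R%:E
     - C A P pi)%E.

Definition optimal_rules (R : realType) (Theta : finType) (C : cost R Theta)
    (pi : Theta -> R) (A : {fset {ffun Theta -> R}})
  : set (Theta -> A -> R) :=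
  [set P | experiment P /\ forall Q : Theta -> A -> R, experiment Q ->
    (net_payoff C pi Q <= net_payoff C pi P)%E].

Arguments optimal_rules {R Theta} C pi A.

(* phi is a function on [0, +oo[, extended arbitrarily to the negative
   numbers. *)
Record transformation (R : realType) (phi : R -> \bar R) : Prop := {
  transformation_ge0 : forall t, 0 <= t -> (0 <= phi t)%E;
  transformation_convex :
    econvex_on (E := R^o) [set t : R | 0 <= t] phi;
  transformation_lsc : lsc_on [set t : R | 0 <= t] phi;
  transformation_at1 : phi 1 = 0%E;
  transformation_superlinear :
    (phi t * (t^-1)%:E)%E @[t --> +oo%R] --> +oo%E;
  transformation_strict :
    strictly_econvex_on (E := R^o)
      (interior (dom_on [set t : R | 0 <= t] phi)) phi;
  transformation_dom1 : interior (dom_on [set t : R | 0 <= t] phi) 1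
}.

(* The derivatives at t > 0 of "fine \o phi" are those of phi whenever phi is
   finite on ]0, +oo[. *)
Definition essentially_smooth (R : realType) (phi : R -> \bar R) : Prop :=
  (forall t : R, 0 < t -> phi t \is a fin_num /\ derivable (fine \o phi) t 1)
  /\ derive1 (fine \o phi) t @[t --> 0^'+] --> -oo.

Definition C3_pos_deriv2 (R : realType) (phi : R -> \bar R) : Prop :=
  forall t : R, 0 < t ->
    [/\ forall n, (n < 3)%N -> derivable (derive1n n (fine \o phi)) t 1,
        {for t, continuous (derive1n 3 (fine \o phi))} &
        0 < derive1n 2 (fine \o phi) t].

(* alpha * phi (x / alpha) *)
Definition perspective (R : realType) (phi : R -> \bar R) (x alpha : R)
  : \bar R :=
  if alpha == 0
  then lim ((phi (1 + t * x)%R * (t^-1)%:E)%E @[t --> +oo%R])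
  else (alpha%:E * phi (x / alpha)%R)%E.

(* The infimum is attained: alpha ranges over a compact set and the objective
   is lower semicontinuous. *)
Definition csiszar_cost (R : realType) (Theta : finType) (phi : R -> \bar R)
  : cost R Theta := fun S P pi =>
  ereal_inf [set (\sum_theta (pi theta)%:E *
                   \sum_s perspective phi (P theta s) (alpha s))%E
            | alpha in @simplex R S].

Arguments csiszar_cost {R Theta} phi S P pi.

Record posterior_family (R : realType) (Theta : finType)
    (H : (Theta -> R) -> (Theta -> R) -> \bar R) : Prop := {
  posterior_family_ge0 : forall pi, full_support_prior pi ->
    forall p, simplex p -> (0 <= H pi p)%E;
  posterior_family_convex : forall pi, full_support_prior pi ->
    econvex_on (@simplex R Theta) (H pi);
  posterior_family_lsc : forall pi, full_support_prior pi ->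
    lsc_on (@simplex R Theta : set {ptws Theta -> R}) (H pi);
  posterior_family_prior : forall pi, full_support_prior pi -> H pi pi = 0%E;
  posterior_family_strict : forall pi, full_support_prior pi ->
    strictly_econvex_on (dom_on (@simplex R Theta) (H pi)) (H pi);
  posterior_family_relint : forall pi, full_support_prior pi ->
    relative_interior (dom_on (@simplex R Theta) (H pi)) pi
}.

Definition posterior_separable_cost (R : realType) (Theta : finType)
    (H : (Theta -> R) -> (Theta -> R) -> \bar R) : cost R Theta :=
  fun S P pi =>
  (\sum_(s | (0 < marginal P pi s)%R)
     (marginal P pi s)%:E * H pi (posterior P pi s))%E.

Arguments posterior_separable_cost {R Theta} H S P pi.

Definition kl_divergence (R : realType) (S : finType) (beta alpha : S -> R)
  : \bar R :=
  (\sum_s if beta s == 0%R then 0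
          else if alpha s == 0%R then +oo
          else (beta s * ln (beta s / alpha s))%R%:E)%E.

Definition mutual_information (R : realType) (Theta : finType)
  : cost R Theta := fun S P pi =>
  (\sum_theta (pi theta)%:E * kl_divergence (P theta) (marginal P pi))%E.

Arguments mutual_information {R Theta} S P pi.

(* Main.v *)
Require Import Defs.
From HB Require Import structures.
From mathcomp Require Import all_boot all_order all_algebra finmap.
From mathcomp Require Import all_classical all_reals all_analysis.
From mathcomp Require Import ring lra.

Set Implicit Arguments.
Unset Strict Implicit.
Unset Printing Implicit Defensive.

Import Order.TTheory GRing.Theory Num.Theory.
Import numFieldNormedType.Exports.

Local Open Scope classical_set_scope.
Local Open Scope ring_scope.

(** Write D for the derivative of phi and f(t) = t D(t) - phi(t), which is the
    convex conjugate of phi at the slope D(t).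

    If points x_a, a in A, of the positive orthant lie on one level set of
    x |-> sum_theta pi(theta) f(x(theta)) and sum_a w_a x_a = 1 for a probability
    vector w, then the rule P_theta(a) = w_a x_a(theta) is optimal for the Csiszar
    cost in the problem with actions D o x_a, by Young's inequality.  A
    posterior-separable objective depends only on the posteriors, up to weights
    on which it is linear; so if it has the same optima, then every rule
    P_theta(a) = v_a x_a(theta) is optimal as well.  For the Csiszar cost,
    however, such a rule is optimal only if sum_a v_a <= 1.  Hence every linear
    relation between the x_a has coefficients summing to zero.

    Apply this to priors (q, 1 - q) on two blocks of states and to three points
    (t_i, u_i) with fixed t_1 < 1 = t_2 < t_3.  As q -> 0 the level set is, after
    rescaling the second coordinate, the graph of -f, so the three points
    (t_i, f(t_i)) are collinear and f(t) = k (t - 1).  Integrating,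
    phi(t) = k (t ln t - t + 1), whose cost is k times mutual information.
    Conversely mutual information is posterior separable, with H the relative
    entropy to the prior. *)

(** * Transformations and their perspectives *)

Section Transformation.
Context {R : realType} (phi : R -> \bar R).
Hypothesis phi_tr : transformation phi.
Hypothesis phi_smooth : essentially_smooth phi.
Hypothesis phi_C3 : C3_pos_deriv2 phi.

Definition slope (psi : R -> \bar R) : R -> R := derive1 (fine \o psi).
Let D := slope phi.

(* This is phi^* (phi' t), where phi^* is the convex conjugate of phi. *)
Definition conjugate_at_slope (psi : R -> \bar R) (t : R) : R :=
  t * slope psi t - fine (psi t).
Let f := conjugate_at_slope phi.

Lemma transformation_EFin (t : R) : 0 < t -> phi t = (fine (phi t))%:E.
Proof. by move=> t0; rewrite fineK//; exact: (phi_smooth.1 _ t0).1. Qed.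

Lemma is_derive_transformation (t : R) : 0 < t -> is_derive t 1 (fine \o phi) (D t).
Proof.
by move=> t0; rewrite /D /slope derive1E; apply/derivableP; exact: (phi_smooth.1 _ t0).2.
Qed.

Lemma is_derive_slope (t : R) : 0 < t -> is_derive t 1 D (derive1 D t).
Proof.
move=> t0; rewrite derive1E; apply/derivableP.
by have [dD _ _] := phi_C3 t0; exact: (dD 1%N isT).
Qed.

Lemma derive1_slope_gt0 (t : R) : 0 < t -> 0 < derive1 D t.
Proof. by move=> t0; have [_ _ dD] := phi_C3 t0; exact: dD. Qed.

Lemma is_derive_continuous (g : R -> R) (dg t : R) :
  is_derive t 1 g dg -> {for t, continuous g}.
Proof. by case=> dg' _; exact/differentiable_continuous/derivable1_diffP. Qed.

Lemma derive_MVT (g dg : R -> R) (a b : R) :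
  0 < a -> a < b -> (forall t : R, 0 < t -> is_derive t 1 g (dg t)) ->
  exists2 c, a < c < b & g b - g a = dg c * (b - a).
Proof.
move=> a0 ab dP.
have [||c] := MVT ab (df := dg) (f := g).
- by move=> t; rewrite in_itv/= => /andP[at_ _]; apply: dP; exact: lt_trans at_.
- apply: derivable_within_continuous => t; rewrite in_itv/= => /andP[at_ _].
  by have [] := dP t (lt_le_trans a0 at_).
by rewrite in_itv/= => ? ?; exists c.
Qed.

Lemma slope_lt (a b : R) : 0 < a -> a < b -> D a < D b.
Proof.
move=> a0 ab; have [c /andP[ac _]] := derive_MVT a0 ab is_derive_slope.
rewrite -subr_gt0 => ->; rewrite mulr_gt0 ?subr_gt0//.
by apply: derive1_slope_gt0; exact: lt_trans ac.
Qed.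

Lemma slope_inj (a b : R) : 0 < a -> 0 < b -> D a = D b -> a = b.
Proof.
by move=> a0 b0 Dab; case: (ltgtP a b) => // ab;
  [have := slope_lt a0 ab|have := slope_lt b0 ab]; rewrite Dab ltxx.
Qed.

Lemma tangent_le (x y : R) : 0 < x -> 0 < y ->
  fine (phi x) + D x * (y - x) <= fine (phi y).
Proof.
move=> x0 y0; case: (ltgtP x y) => [xy|yx|->]; last by rewrite subrr mulr0 addr0.
- have [c /andP[xc cy] /= E] := derive_MVT x0 xy is_derive_transformation.
  rewrite -lerBrDl E ler_wpM2r ?subr_ge0 ?(ltW xy)//; exact/ltW/slope_lt.
- have [c /andP[yc cx] /= E] := derive_MVT y0 yx is_derive_transformation.
  have /ltW Dc := slope_lt (lt_trans y0 yc) cx.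
  have := ler_wpM2r (ltW (eq_ind_r is_true yx (subr_gt0 y x))) Dc; rewrite -E; lra.
Qed.

(** Young's inequality for [phi] at the slope [D x]. At [y = 0], where [phi] has no derivative and
    may be infinite, it follows from convexity at the midpoint [x / 2] and the tangent bound
    there. *)
Lemma transformation_ge_tangent (x y : R) : 0 < x -> 0 <= y ->
  ((y * D x - f x)%:E <= phi y)%E.
Proof.
move=> x0; rewrite le_eqVlt => /predU1P[<-|y0]; last first.
  rewrite (transformation_EFin y0) lee_fin.
  by have := tangent_le x0 y0; rewrite /f /conjugate_at_slope -/D; lra.
have x20 : 0 < x / 2 by lra.
have := transformation_convex phi_tr (x := 0) (y := x) (t := 2^-1).
have half01 : 0 <= (2^-1 : R) <= 1 by rewrite invr_ge0 ler0n invf_le1// ler1n.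
move=> /(_ (lexx 0) (ltW x0) half01).
have -> : 2^-1 *: (0 : R^o) + (1 - 2^-1) *: x = x / 2.
  by rewrite scaler0 add0r /GRing.scale/=; lra.
rewrite (transformation_EFin x20) (transformation_EFin x0).
have := transformation_ge0 phi_tr (lexx 0).
case: (phi 0) => [r r0|_ _|//]; last by rewrite leey.
rewrite -!EFinM -EFinD !lee_fin.
by have := tangent_le x0 x20; rewrite /f /conjugate_at_slope -/D; lra.
Qed.

Lemma perspective0_gt (y : R) : 0 < y -> perspective phi y 0 = +oo%E.
Proof.
move=> y0; rewrite /perspective eqxx; apply/cvg_lim => //.
apply/cvgeyPge => A; have [A0|A0] := leP 0 A; last first.
  near=> t; apply: (@le_trans _ _ 0%E); first by rewrite lee_fin ltW.
  have t0 : 0 < t by near: t; exact: nbhs_pinfty_gt.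
  apply: mule_ge0; last by rewrite lee_fin invr_ge0 ltW.
  by apply: (transformation_ge0 phi_tr); rewrite addr_ge0// mulr_ge0// ltW.
(* The threshold [A / y] gives phi(1 + t y) / t >= (A / y)(1 + t y) / t >= A. *)
have /cvgeyPge/(_ (A / y)) := transformation_superlinear phi_tr.
case=> M [_ HM]; near=> t.
have t0 : 0 < t by near: t; exact: nbhs_pinfty_gt.
have tM : M / y < t by near: t; apply: nbhs_pinfty_gt; rewrite num_real.
have s0 : 0 < 1 + t * y by rewrite addr_gt0// mulr_gt0.
have sM : M < 1 + t * y by rewrite ltr_pdivrMr// in tM; lra.
have := HM _ sM; rewrite /= (transformation_EFin s0) -!EFinM !lee_fin.
rewrite ler_pdivlMr// ler_pdivlMr// => /(le_trans _); apply.
have -> : A / y * (1 + t * y) = A / y + A * t.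
  by rewrite mulrDr mulr1 (mulrC t) mulrA divfK ?gt_eqF.
by rewrite ler_wpDl// divr_ge0// ltW.
Unshelve. all: by end_near. Qed.

Lemma perspective00 : perspective phi 0 0 = 0%E.
Proof.
rewrite /perspective eqxx; apply/cvg_lim => //.
under eq_fun => t do rewrite mulr0 addr0 (transformation_at1 phi_tr) mul0e.
exact: cvg_cst.
Qed.

(** Young's inequality at [y / b], multiplied by [b]. For [b = 0] the perspective is 0 or [+oo]. *)
Lemma perspective_ge_tangent (x y b : R) : 0 < x -> 0 <= y -> 0 <= b ->
  ((y * D x - b * f x)%:E <= perspective phi y b)%E.
Proof.
move=> x0 y0; rewrite le_eqVlt => /predU1P[<-|b0].
  move: y0; rewrite le_eqVlt => /predU1P[<-|y0].
    by rewrite perspective00 !mul0r subrr.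
  by rewrite (perspective0_gt y0) leey.
rewrite /perspective gt_eqF//.
have := transformation_ge_tangent x0 (divr_ge0 y0 (ltW b0)).
move/(lee_wpmul2l (ltW (b0 : 0 < b%:E)%E)); apply: le_trans.
rewrite -EFinM lee_fin.
suff -> : b * (y / b * D x - f x) = y * D x - b * f x by [].
by field; rewrite gt_eqF.
Qed.

Lemma perspective_scale (x b : R) : 0 < x -> 0 <= b ->
  perspective phi (b * x) b = (b * fine (phi x))%:E.
Proof.
move=> x0; rewrite le_eqVlt => /predU1P[<-|b0].
  by rewrite !mul0r perspective00.
by rewrite /perspective gt_eqF// mulrAC mulfV ?gt_eqF// mul1r (transformation_EFin x0).
Qed.

Lemma conjugate_at_slope_sub_le (x z : R) : 0 < x -> 0 < z ->
  f z - f x <= z * (D z - D x).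
Proof.
by move=> x0 z0; have := tangent_le x0 z0; rewrite /f /conjugate_at_slope -/D; lra.
Qed.

(** Since [phi] is nonnegative and vanishes at 1, the point 1 is a minimizer. *)
Lemma slope1 : D 1 = 0.
Proof.
have phi1 : fine (phi 1) = 0 by rewrite (transformation_at1 phi_tr).
rewrite /D /slope derive1E; apply: derive_val.
apply: (@derive1_at_min R (fine \o phi) (1/2) (3/2)).
- by lra.
- move=> t; rewrite in_itv/= => /andP[t1 t2]; apply: (phi_smooth.1 t _).2; lra.
- by rewrite in_itv/=; apply/andP; split; lra.
- move=> t; rewrite in_itv/= => /andP[t1 t2]; rewrite /= phi1.
  apply: fine_ge0; apply: (transformation_ge0 phi_tr); lra.
Qed.

Lemma conjugate_at_slope1 : f 1 = 0.
Proof.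
by rewrite /f /conjugate_at_slope -/D slope1 (transformation_at1 phi_tr) mulr0 subr0.
Qed.

Lemma perspective_ge0 (y b : R) : 0 <= y -> 0 <= b -> (0 <= perspective phi y b)%E.
Proof.
move=> y0 b0; have := perspective_ge_tangent ltr01 y0 b0.
by rewrite conjugate_at_slope1 slope1 !mulr0 subr0.
Qed.

Lemma is_derive_conjugate_at_slope (t : R) : 0 < t ->
  is_derive t 1 f (t * derive1 D t).
Proof.
move=> t0; have Dt := is_derive_slope t0; have pt := is_derive_transformation t0.
rewrite /f /conjugate_at_slope.
have -> : (fun t => t * slope phi t - fine (phi t)) = id * D - (fine \o phi).
  by apply/funext.
apply: is_derive_eq; rewrite /GRing.scale/=; ring.
Qed.

Lemma conjugate_at_slope_lt (a b : R) : 0 < a -> a < b -> f a < f b.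
Proof.
move=> a0 ab; have [c /andP[ac _]] := derive_MVT a0 ab is_derive_conjugate_at_slope.
rewrite -subr_gt0 => ->; have c0 := lt_trans a0 ac.
by rewrite !mulr_gt0 ?subr_gt0 ?derive1_slope_gt0.
Qed.

End Transformation.

(** * Duality for the Csiszar cost *)

Lemma exists_pos_lower_bound (R : realType) (I : finType) (g : I -> R) :
  (forall i, 0 < g i) -> exists2 e, 0 < e & forall i, e <= g i.
Proof.
move=> g0; exists (\big[Num.min/1]_i g i); last by move=> i; exact: bigmin_le_cond.
by elim/big_ind : _ => //= x y x0 y0; rewrite lt_min x0.
Qed.

Lemma sum_simplex_pos (R : realType) (I : finType) (p g : I -> R) :
  simplex p -> (forall i, 0 < g i) -> 0 < \sum_i p i * g i.
Proof.
move=> [p0 p1] /exists_pos_lower_bound[e e0 eg].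
apply: (lt_le_trans e0); rewrite -[leLHS]mul1r -p1 mulr_suml.
by apply: ler_sum => i _; exact: ler_wpM2l.
Qed.

Section Csiszar.
Context {R : realType} {Theta S : finType} (phi : R -> \bar R) (pi : Theta -> R).
Hypothesis phi_tr : transformation phi.
Hypothesis phi_smooth : essentially_smooth phi.
Hypothesis phi_C3 : C3_pos_deriv2 phi.
Hypothesis pi_full : full_support_prior pi.

Let D := slope phi.
Let f := conjugate_at_slope phi.

(** Weak duality: any choice of tangent points [z], which may depend on [b], bounds the objective
    from below. *)
Lemma csiszar_objective_ge (Q : Theta -> S -> R) (b : S -> R) (z : S -> Theta -> R) :
  experiment Q -> simplex b -> (forall s th, 0 < z s th) ->
  ((\sum_s \sum_th pi th * (Q th s * D (z s th) - b s * f (z s th)))%:E <=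
   \sum_th (pi th)%:E * \sum_s perspective phi (Q th s) (b s))%E.
Proof.
move=> Qexp [b0 _] z0; rewrite exchange_big/= -sumEFin; apply: lee_sum => th _.
rewrite -mulr_sumr EFinM; apply: lee_wpmul2l; first by rewrite lee_fin ltW// pi_full.2.
rewrite -sumEFin; apply: lee_sum => s _.
by apply: perspective_ge_tangent => //; exact: (Qexp th).1.
Qed.

Variables (x : S -> Theta -> R) (mu : R).
Hypothesis x_gt0 : forall s th, 0 < x s th.
Hypothesis x_level : forall s, \sum_th pi th * f (x s th) = mu.

Definition scaled_rule (y : S -> Theta -> R) (w : S -> R) : Theta -> S -> R :=
  fun th s => w s * y s th.

Definition utility (Q : Theta -> S -> R) : R :=
  \sum_th pi th * \sum_s Q th s * D (x s th).

(** With tangent points on the level set, the terms in [b] add up to [mu] for every probability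
    vector [b], so the dual bound passes to the infimum. It caps the net payoff at [mu]. *)
Lemma csiszar_cost_ge (Q : Theta -> S -> R) : experiment Q ->
  ((utility Q - mu)%:E <= csiszar_cost phi S Q pi)%E.
Proof.
move=> Qexp; apply/ereal_infP => _ [b bS <-].
apply: le_trans (csiszar_objective_ge Qexp bS x_gt0); rewrite lee_fin.
rewrite le_eqVlt; apply/orP; left; apply/eqP.
under [RHS]eq_bigr => s _ do (under eq_bigr => th _ do rewrite mulrBr; rewrite sumrB).
rewrite sumrB; congr (_ - _).
  by rewrite exchange_big; apply: eq_bigr => th _; rewrite mulr_sumr.
under eq_bigr => s _ do (under eq_bigr => th _ do rewrite mulrCA; rewrite -mulr_sumr x_level).
by rewrite -mulr_suml bS.2 mul1r.
Qed.

(** The reference distribution [w] makes every likelihood ratio equal to [x s th], where Young's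
    inequality is an equality; the cap [mu] is therefore reached. *)
Lemma csiszar_cost_scaled_rule (w : S -> R) : simplex w ->
  (csiszar_cost phi S (scaled_rule x w) pi <= (utility (scaled_rule x w) - mu)%:E)%E.
Proof.
move=> wS; apply: ge_ereal_inf.
exists (\sum_th (pi th)%:E *
  \sum_s perspective phi (scaled_rule x w th s) (w s))%E.
  by exists w.
under eq_bigr => th _.
  under eq_bigr => s _ do rewrite /scaled_rule (perspective_scale phi_tr phi_smooth) ?x_gt0 ?wS.1//.
  rewrite sumEFin -EFinM; over.
rewrite sumEFin lee_fin le_eqVlt; apply/orP; left; apply/eqP.
have -> : mu = \sum_th pi th * \sum_s w s * f (x s th).
  rewrite -[LHS]mul1r -wS.2 mulr_suml.
  rewrite (eq_bigr (fun s => \sum_th w s * (pi th * f (x s th)))); last first.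
    by move=> s _; rewrite -(x_level s) mulr_sumr.
  rewrite exchange_big/=; apply: eq_bigr => th _; rewrite mulr_sumr.
  by apply: eq_bigr => s _; rewrite mulrCA.
rewrite /utility -sumrB; apply: eq_bigr => th _; rewrite -mulrBr -sumrB; congr (_ * _).
by apply: eq_bigr => s _; rewrite /scaled_rule /f /conjugate_at_slope -/D; ring.
Qed.

(* Dual bound with the tangent points moved to c * x s, for some c strictly
   between 1 and the total weight, wherever b s is so small that this helps. *)
Lemma csiszar_cost_scaled_rule_gt (w : S -> R) :
  experiment (scaled_rule x w) -> (forall s, 0 <= w s) -> 1 < \sum_s w s ->
  ((utility (scaled_rule x w) - mu)%:E < csiszar_cost phi S (scaled_rule x w) pi)%E.
Proof.
move=> wexp w0 w1; set c : R := (1 + \sum_s w s) / 2.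
have c1 : 1 < c by rewrite /c; lra.
have c0 : 0 < c by lra.
have xcx s th : x s th < c * x s th by rewrite ltr_pMl ?x_gt0.
(* Moving the tangent points of [s] raises the bound by at least [k s * (w s - c * b s)]. The common
   bound [e] on [k] makes the total gain independent of [b], so that it survives the infimum. *)
pose k s := \sum_th pi th * ((D (c * x s th) - D (x s th)) * x s th).
have [s|e e0 ek] := exists_pos_lower_bound (g := k).
  apply: sum_simplex_pos; first exact: pi_full.1.
  by move=> th; rewrite mulr_gt0// subr_gt0; exact: slope_lt.
apply: (@lt_le_trans _ _ (utility (scaled_rule x w) - mu + e * (\sum_s w s - c))%:E).
  by rewrite lte_fin ltrDl mulr_gt0//; rewrite /c; lra.
apply/ereal_infP => _ [b bS <-].
pose z s th := if c * b s <= w s then c * x s th else x s th.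
have z0 s th : 0 < z s th by rewrite /z; case: ifP => _ //; rewrite mulr_gt0.
apply: le_trans (csiszar_objective_ge wexp bS z0); rewrite lee_fin.
have -> : utility (scaled_rule x w) - mu + e * (\sum_s w s - c) =
  \sum_s (\sum_th pi th * (scaled_rule x w th s * D (x s th) - b s * f (x s th))
          + e * (w s - c * b s)).
  rewrite big_split/= -mulr_sumr sumrB -mulr_sumr bS.2 mulr1; congr (_ + _).
  rewrite /utility.
  under [RHS]eq_bigr => s _ do (under eq_bigr => th _ do rewrite mulrBr; rewrite sumrB).
  rewrite sumrB; congr (_ - _).
    by rewrite exchange_big; apply: eq_bigr => th _; rewrite mulr_sumr.
  under eq_bigr => s _ do (under eq_bigr => th _ do rewrite mulrCA; rewrite -mulr_sumr x_level).
  by rewrite -mulr_suml bS.2 mul1r.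
apply: ler_sum => s _; rewrite /z; case: (leP (c * b s) (w s)) => cbw; last first.
  by rewrite gerDl mulr_ge0_le0 ?(ltW e0)// subr_le0 ltW.
apply: (@le_trans _ _ (\sum_th pi th * (scaled_rule x w th s * D (x s th) - b s * f (x s th))
          + k s * (w s - c * b s))).
  by rewrite lerD2l ler_wpM2r// subr_ge0.
rewrite /k mulr_suml -big_split/=; apply: ler_sum => th _; rewrite -mulrA -mulrDr.
apply: ler_wpM2l; first exact/ltW/pi_full.2.
have := conjugate_at_slope_sub_le phi_smooth phi_C3 (x_gt0 s th) (mulr_gt0 c0 (x_gt0 s th)).
move=> /(ler_wpM2l (bS.1 s)).
by rewrite /scaled_rule -/D -/f; lra.
Qed.

End Csiszar.

(** * Linearity of the posterior-separable objective *)

Section PosteriorSeparable.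
Context {R : realType} {Theta : finType} (pi : Theta -> R).
Context (H : (Theta -> R) -> (Theta -> R) -> \bar R).
Context (A : {fset {ffun Theta -> R}}) (x : A -> Theta -> R).
Hypothesis pi_full : full_support_prior pi.
Hypothesis H_family : posterior_family H.
Hypothesis x_gt0 : forall a th, 0 < x a th.

Let M a := \sum_th pi th * x a th.
Let post a : Theta -> R := fun th => pi th * x a th / M a.

Lemma mass_gt0 a : 0 < M a.
Proof. exact: (sum_simplex_pos pi_full.1). Qed.

Lemma simplex_post a : simplex (post a).
Proof.
split=> [th|]; first by rewrite /post !mulr_ge0 ?invr_ge0 ?ltW ?mass_gt0 ?x_gt0 ?pi_full.2.
by rewrite -mulr_suml mulfV// gt_eqF// mass_gt0.
Qed.

Lemma marginal_scaled_rule (v : A -> R) a : marginal (scaled_rule x v) pi a = v a * M a.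
Proof.
by rewrite /marginal mulr_sumr; apply: eq_bigr => th _; rewrite /scaled_rule mulrCA.
Qed.

(** The weight cancels in Bayes' rule, so it affects only the probability of the signal. *)
Lemma posterior_scaled_rule (v : A -> R) a : 0 < v a ->
  posterior (scaled_rule x v) pi a = post a.
Proof.
move=> va0; apply/funext => th; rewrite /posterior marginal_scaled_rule /scaled_rule /post.
have M0 := mass_gt0 a.
by field; rewrite !gt_eqF.
Qed.

Lemma posterior_scaled_rule_cost (v : A -> R) : (forall a, 0 <= v a) ->
  posterior_separable_cost H A (scaled_rule x v) pi =
  (\sum_(a | (0 < v a)%R) (v a * M a)%:E * H pi (post a))%E.
Proof.
move=> v0; rewrite /posterior_separable_cost.
have vM a : (0 < v a * M a) = (0 < v a) by rewrite pmulr_lgt0// mass_gt0.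
under eq_bigl => a do rewrite marginal_scaled_rule vM.
by apply: eq_bigr => a va; rewrite marginal_scaled_rule posterior_scaled_rule.
Qed.

(** Always choosing [a0] leaves the posterior at the prior and costs nothing. This finite benchmark
    excludes infinite costs at an optimum. *)
Lemma uninformative_payoff (a0 : A) :
  let U : Theta -> A -> R := fun _ a => (a == a0)%:R in
  experiment U /\ exists r, net_payoff (posterior_separable_cost H) pi U = r%:E.
Proof.
move=> U; split.
  move=> th; split=> [a|]; first by rewrite /U; case: eqP.
  by rewrite (bigD1 a0)//= /U eqxx big1 ?addr0// => a /negbTE ->.
have Um a : marginal U pi a = (a == a0)%:R.
  by rewrite /marginal -mulr_suml pi_full.1.2 mul1r.
have -> : net_payoff (posterior_separable_cost H) pi U =
    ((\sum_theta pi theta * \sum_(a : A) U theta a * val a theta)%:E - 0)%E.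
  rewrite /net_payoff; congr (_ - _)%E; rewrite /posterior_separable_cost big1// => a.
  rewrite Um; case: eqP => [-> _|]; last by rewrite ltxx.
  have -> : posterior U pi a0 = pi.
    by apply/funext => th; rewrite /posterior Um /U eqxx mulr1 divr1.
  by rewrite (posterior_family_prior H_family)// mule0.
by rewrite sube0; eexists.
Qed.

Lemma optimal_scaled_rule_fin (w : A -> R) (a0 : A) : (forall a, 0 < w a) ->
  optimal_rules (posterior_separable_cost H) pi A (scaled_rule x w) ->
  forall a, H pi (post a) \is a fin_num.
Proof.
move=> w0 [_ Popt] a.
have H0 b : (0 <= H pi (post b))%E.
  by apply: (posterior_family_ge0 H_family) => //; exact: simplex_post.
have [Uexp [r Ur]] := uninformative_payoff a0.
have := Popt _ Uexp; rewrite Ur /net_payoff posterior_scaled_rule_cost; last first.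
  by move=> b; exact: ltW.
rewrite (bigD1 a)//=.
have rest0 : (0 <= \sum_(i | (0 < w i)%R && (i != a)) (w i * M i)%:E * H pi (post i))%E.
  by apply: sume_ge0 => b _; rewrite mule_ge0// lee_fin ltW// mulr_gt0// mass_gt0.
have wM : 0 < w a * M a by rewrite mulr_gt0// mass_gt0.
case: (H pi (post a)) (H0 a) => [//|_|//].
rewrite gt0_muley ?lte_fin//.
case: (X in (+oo + X)%E) rest0 => [s _||//] //=.
Qed.

Lemma net_payoff_scaled_rule (v : A -> R) : (forall a, 0 <= v a) ->
  (forall a, H pi (post a) \is a fin_num) ->
  net_payoff (posterior_separable_cost H) pi (scaled_rule x v) =
  (\sum_a v a * (\sum_th pi th * x a th * val a th - M a * fine (H pi (post a))))%:E.
Proof.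
move=> v0 Hfin; rewrite /net_payoff posterior_scaled_rule_cost//.
rewrite (eq_bigr (fun a => (v a * M a * fine (H pi (post a)))%:E)); last first.
  by move=> a _; rewrite [RHS]EFinM fineK.
rewrite sumEFin -EFinB; congr (_%:E).
have -> : \sum_(a | 0 < v a) v a * M a * fine (H pi (post a)) =
    \sum_a v a * (M a * fine (H pi (post a))).
  rewrite big_mkcond; apply: eq_bigr => a _; case: ltP => [_|va]; first by rewrite mulrA.
  by have -> : v a = 0 by [apply/eqP; rewrite eq_le va v0]; rewrite mul0r.
under [RHS]eq_bigr => a _ do rewrite mulrBr.
rewrite sumrB; congr (_ - _).
under eq_bigr => th _ do rewrite mulr_sumr.
rewrite exchange_big/=; apply: eq_bigr => a _; rewrite mulr_sumr; apply: eq_bigr => th _.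
by rewrite /scaled_rule; ring.
Qed.

(* The payoff is linear in the weights, so an optimum in the relative interior
   of a segment of weights forces the whole segment to be optimal. *)
Lemma optimal_scaled_rule_add (a0 : A) (w g : A -> R) :
  (forall a, 0 < w a) -> (forall a, `|g a| <= w a) ->
  (forall th, \sum_a g a * x a th = 0) ->
  optimal_rules (posterior_separable_cost H) pi A (scaled_rule x w) ->
  optimal_rules (posterior_separable_cost H) pi A (scaled_rule x (w \+ g)).
Proof.
move=> w0 gw gx Popt; have [Pexp Pmax] := Popt.
have exp_add (h : A -> R) : (forall a, `|h a| <= w a) ->
    (forall th, \sum_a h a * x a th = 0) -> experiment (scaled_rule x (w \+ h)).
  move=> hw hx th; split=> [a|].
    rewrite mulr_ge0 ?(ltW (x_gt0 _ _))//=.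
    by have := hw a; rewrite ler_norml => /andP[]; lra.
  rewrite /scaled_rule (eq_bigr (fun a => w a * x a th + h a * x a th)); last first.
    by move=> a _; rewrite mulrDl.
  by rewrite big_split/= hx addr0; exact: (Pexp th).2.
have ge0_add (h : A -> R) : (forall a, `|h a| <= w a) -> forall a, 0 <= (w \+ h) a.
  by move=> hw a /=; have := hw a; rewrite ler_norml => /andP[]; lra.
split; first exact: exp_add.
move=> Q Qexp; apply: (le_trans (Pmax _ Qexp)).
have Hfin := optimal_scaled_rule_fin a0 w0 Popt.
have gNw a : `|(\- g) a| <= w a by rewrite /= normrN.
have gNx th : \sum_a (\- g) a * x a th = 0.
  by under eq_bigr => a _ do rewrite /= mulNr; rewrite sumrN gx oppr0.
(* By linearity, that [w] does at least as well as [w - g] means that [w + g] does at least as well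
   as [w]. *)
have := Pmax _ (exp_add _ gNw gNx).
have wg0 := ge0_add _ gw; have wNg0 := ge0_add _ gNw.
have wge0 a : 0 <= w a by exact: ltW.
rewrite !net_payoff_scaled_rule// !lee_fin.
rewrite -subr_ge0 -sumrB => E; rewrite -subr_ge0 -sumrB.
apply: (le_trans E); apply: ler_sum => a _ /=.
rewrite le_eqVlt; apply/orP; left; apply/eqP; ring.
Qed.

End PosteriorSeparable.

(** * Linear relations on level sets *)

Section LevelSet.
Context {R : realType} {Theta : finType} (phi : R -> \bar R) (pi : Theta -> R).
Hypothesis phi_tr : transformation phi.
Hypothesis phi_smooth : essentially_smooth phi.
Hypothesis phi_C3 : C3_pos_deriv2 phi.
Hypothesis pi_full : full_support_prior pi.

Let D := slope phi.
Let f := conjugate_at_slope phi.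

(** The optimal value is [mu]: the dual bound caps every payoff, and [w] reaches the cap. A rule of
    total weight above 1 has a strictly larger cost than its dual bound, hence a payoff below
    [mu]. *)
Lemma scaled_rule_csiszar_optimal (A : {fset {ffun Theta -> R}}) (x : A -> Theta -> R)
    (mu : R) (w : A -> R) :
  (forall a th, 0 < x a th) -> (forall (a : A) th, val a th = D (x a th)) ->
  (forall a, \sum_th pi th * f (x a th) = mu) -> simplex w ->
  (forall th, \sum_a w a * x a th = 1) ->
  optimal_rules (csiszar_cost phi) pi A (scaled_rule x w) /\
  forall v : A -> R, (forall a, 0 <= v a) ->
    optimal_rules (csiszar_cost phi) pi A (scaled_rule x v) -> \sum_a v a <= 1.
Proof.
move=> x0 xD xmu wS wx.
have net_payoffE (Q : Theta -> A -> R) : net_payoff (csiszar_cost phi) pi Q =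
    ((utility phi pi x Q)%:E - csiszar_cost phi A Q pi)%E.
  rewrite /net_payoff /utility; congr (_%:E - _)%E; apply: eq_bigr => th _.
  by congr (_ * _); apply: eq_bigr => a _; rewrite xD.
have Pexp : experiment (scaled_rule x w).
  by move=> th; split=> [a|]; [rewrite mulr_ge0 ?wS.1// ltW|exact: wx].
have P_ge : (mu%:E <= net_payoff (csiszar_cost phi) pi (scaled_rule x w))%E.
  rewrite net_payoffE; have := csiszar_cost_scaled_rule phi_tr phi_smooth x0 xmu wS.
  have : (0 <= csiszar_cost phi A (scaled_rule x w) pi)%E.
    apply/ereal_infP => _ [b bS <-]; apply: sume_ge0 => th _; apply: mule_ge0.
      by rewrite lee_fin ltW// pi_full.2.
    apply: sume_ge0 => a _; apply: perspective_ge0 => //; [exact: (Pexp th).1|exact: bS.1].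
  case: (csiszar_cost _ _ _ _) => [c|//|//] _; rewrite -EFinB !lee_fin; lra.
split.
  split=> // Q Qexp; apply: le_trans P_ge; rewrite net_payoffE.
  have := csiszar_cost_ge phi_tr phi_smooth phi_C3 pi_full x0 xmu Qexp.
  case: (csiszar_cost _ _ _ _) => [c|_|//]; last by rewrite leNye.
  by rewrite -EFinB !lee_fin; lra.
move=> v v0 [Qexp Qmax]; rewrite leNgt; apply/negP => v1.
have := csiszar_cost_scaled_rule_gt phi_tr phi_smooth phi_C3 pi_full x0 xmu Qexp v0 v1.
have := le_trans P_ge (Qmax _ Pexp); rewrite net_payoffE.
by case: (csiszar_cost _ _ _ _) => [c|//|//]; rewrite -EFinB !lee_fin !lte_fin; lra.
Qed.

Hypothesis sep : forall A : {fset {ffun Theta -> R}}, A != fset0 ->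
  exists2 H : (Theta -> R) -> (Theta -> R) -> \bar R, posterior_family H &
    optimal_rules (posterior_separable_cost H) pi A = optimal_rules (csiszar_cost phi) pi A.

Lemma actions_relation_sum0 (A : {fset {ffun Theta -> R}}) (x : A -> Theta -> R)
    (mu : R) (w g : A -> R) :
  (forall a th, 0 < x a th) -> (forall (a : A) th, val a th = D (x a th)) ->
  (forall a, \sum_th pi th * f (x a th) = mu) ->
  (forall a, 0 < w a) -> \sum_a w a = 1 ->
  (forall th, \sum_a w a * x a th = 1) -> (forall th, \sum_a g a * x a th = 0) ->
  \sum_a g a = 0.
Proof.
move=> x0 xD xmu w0 w1 wx.
wlog g_gt0 : g / 0 < \sum_a g a => [hwlog gx|gx].
  have [g_lt0|g_gt0|//] := ltgtP (\sum_a g a) 0; last exact: hwlog.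
  apply/oppr_inj; rewrite oppr0 -sumrN; apply: hwlog.
    by rewrite sumrN oppr_gt0.
  move=> th; rewrite (eq_bigr (fun a => - (g a * x a th))) ?sumrN ?gx ?oppr0// => a _.
  by rewrite mulNr.
have [a0 _|noA] := pickP A; last by rewrite big_pred0.
have A0 : A != fset0 by apply/fset0Pn; exists (val a0); exact: valP.
have [H HF optE] := sep A0.
have wS : simplex w by split=> // a; exact: ltW.
have [Popt Q_le1] := scaled_rule_csiszar_optimal x0 xD xmu wS wx.
(* A step [e] small enough that [w + e g] and [w - e g] are nonnegative; the [+ 1] avoids a zero
   denominator. Optimality of [w + e g] then bounds its total weight by 1, against
   [0 < \sum_a g a]. *)
have [a|e e0 eg] := @exists_pos_lower_bound R A (fun a => w a / (`|g a| + 1)).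
  by rewrite divr_gt0// ltr_pwDr.
have egw a : `|e * g a| <= w a.
  have := eg a; rewrite ler_pdivlMr ?ltr_pwDr// normrM (gtr0_norm e0) => /(le_trans _); apply.
  by rewrite ler_wpM2l ?lerDl ?(ltW e0).
have egx th : \sum_a e * g a * x a th = 0.
  by under eq_bigr => a _ do rewrite -mulrA; rewrite -mulr_sumr gx mulr0.
rewrite -optE in Popt.
have := optimal_scaled_rule_add pi_full HF x0 a0 w0 egw egx Popt.
rewrite optE => /Q_le1; have wg0 a : 0 <= (w \+ (fun a => e * g a)) a.
  by rewrite /=; have := egw a; rewrite ler_norml => /andP[]; lra.
move=> /(_ wg0); rewrite big_split/= w1 -mulr_sumr.
by have := mulr_gt0 e0 g_gt0; lra.
Qed.

(** Signals are the actions themselves, so indices with equal points are merged and their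
    coefficients added by [push]. Injectivity of [D] ensures that equal actions come from equal
    points. *)
Lemma level_set_relation_sum0 (I : finType) (y : I -> Theta -> R) (mu : R)
    (w g : I -> R) :
  (forall i th, 0 < y i th) -> (forall i, \sum_th pi th * f (y i th) = mu) ->
  (forall i, 0 < w i) -> \sum_i w i = 1 ->
  (forall th, \sum_i w i * y i th = 1) -> (forall th, \sum_i g i * y i th = 0) ->
  \sum_i g i = 0.
Proof.
move=> y0 ymu w0 w1 wy gy.
pose act i : {ffun Theta -> R} := [ffun th => D (y i th)].
pose A : {fset {ffun Theta -> R}} := [fset act i | i in I]%fset.
have actA i : act i \in A by apply/imfsetP; exists i.
pose toA i : A := [` actA i]%fset.
have /choice[r rP] (a : A) : exists i, toA i = a.
  by have /imfsetP[i _ ai] := valP a; exists i; exact/val_inj.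
have y_toA i th : y (r (toA i)) th = y i th.
  have /(congr1 val)/ffunP/(_ th) := rP (toA i).
  by rewrite !ffunE; exact: slope_inj.
pose push (v : I -> R) a := \sum_(i | toA i == a) v i.
have pushE v (F : A -> R) : \sum_a push v a * F a = \sum_i v i * F (toA i).
  rewrite [RHS](partition_big toA predT)//=; apply: eq_bigr => a _.
  by rewrite mulr_suml; apply: eq_bigr => i /eqP ->.
have pushE1 v : \sum_a push v a = \sum_i v i.
  by rewrite [RHS](partition_big toA predT).
rewrite -pushE1; apply: (@actions_relation_sum0 A (fun a => y (r a)) mu (push w)).
- by [].
- by move=> a th; rewrite -[in LHS](rP a) ffunE.
- by [].
- move=> a; rewrite /push (bigD1 (r a)) ?rP//= ltr_pwDl// sumr_ge0// => i _; exact: ltW.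
- by rewrite pushE1.
- by move=> th; rewrite pushE -[RHS](wy th); apply: eq_bigr => i _; rewrite y_toA.
- by move=> th; rewrite pushE -[RHS](gy th); apply: eq_bigr => i _; rewrite y_toA.
Qed.

End LevelSet.

(** * Three-point problems *)

Section Affine.
Context {R : realType} {Theta : finType} (phi : R -> \bar R).
Hypothesis Theta_gt1 : (1 < #|Theta|)%N.
Hypothesis phi_tr : transformation phi.
Hypothesis phi_smooth : essentially_smooth phi.
Hypothesis phi_C3 : C3_pos_deriv2 phi.
Hypothesis sep : forall (pi : Theta -> R) (A : {fset {ffun Theta -> R}}),
  full_support_prior pi -> A != fset0 ->
  exists2 H : (Theta -> R) -> (Theta -> R) -> \bar R, posterior_family H &
    optimal_rules (posterior_separable_cost H) pi A = optimal_rules (csiszar_cost phi) pi A.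

Let D := slope phi.
Let f := conjugate_at_slope phi.

Lemma two_block_relation_sum0 (q : R) (I : finType) (t u : I -> R) (mu : R)
    (w g : I -> R) :
  0 < q < 1 -> (forall i, 0 < t i) -> (forall i, 0 < u i) ->
  (forall i, q * f (t i) + (1 - q) * f (u i) = mu) ->
  (forall i, 0 < w i) -> \sum_i w i = 1 ->
  \sum_i w i * t i = 1 -> \sum_i w i * u i = 1 ->
  \sum_i g i * t i = 0 -> \sum_i g i * u i = 0 -> \sum_i g i = 0.
Proof.
move=> /andP[q0 q1] t0 u0 tumu w0 w1 wt wu gt gu.
have /card_gt0P[th0 _] : (0 < #|Theta|)%N by exact: ltnW.
have N0 : 0 < (#|Theta|.-1)%:R :> R by rewrite ltr0n -subn1 subn_gt0.
(* The first block is the single state [th0]; the other states share the mass [1 - q] equally. *)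
pose pi th : R := if th == th0 then q else (1 - q) / (#|Theta|.-1)%:R.
have pi_sum (G1 G2 : R) : \sum_th pi th * (if th == th0 then G1 else G2) = q * G1 + (1 - q) * G2.
  rewrite (bigD1 th0)//= /pi eqxx; congr (_ + _).
  rewrite (eq_bigr (fun=> (1 - q) / (#|Theta|.-1)%:R * G2)); last by move=> th /negbTE ->.
  rewrite sumr_const cardC1 -mulr_natr; field; exact: lt0r_neq0.
have pi_full : full_support_prior pi.
  have pi0 th : 0 < pi th by rewrite /pi; case: ifP => // _; rewrite divr_gt0// subr_gt0.
  split=> //; split=> [th|]; first exact: ltW.
  have := pi_sum 1 1; under eq_bigr => th _ do rewrite if_same mulr1.
  by move=> ->; ring.
pose y i th := if th == th0 then t i else u i.
apply: (@level_set_relation_sum0 _ _ _ pi phi_tr phi_smooth phi_C3 pi_full _ I y mu w g) => //.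
- by move=> A; exact: sep.
- by move=> i th; rewrite /y; case: ifP.
- move=> i; rewrite -(tumu i) -pi_sum; apply: eq_bigr => th _.
  by rewrite /y; case: ifP.
- by move=> th; rewrite /y; case: (th == th0).
- by move=> th; rewrite /y; case: (th == th0).
Qed.

(* The prior weight q of the first block satisfies q / (1 - q) = h. *)
Lemma three_points_collinear (s t u1 u2 u3 h nu l : R) :
  0 < s < 1 -> 1 < t -> 0 < u1 -> 0 < u2 -> 0 < u3 -> 0 < h ->
  f u1 = nu - h * f s -> f u2 = nu - h * f 1 -> f u3 = nu - h * f t ->
  0 < l -> l * (t - s) < 1 ->
  u2 - 1 = l * ((t - s) * u2 - (t - 1) * u1 - (1 - s) * u3) ->
  (t - s) * u2 - (t - 1) * u1 - (1 - s) * u3 = 0.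
Proof.
move=> /andP[s0 s1] t1 u10 u20 u30 h0 fu1 fu2 fu3 l0 l1 u2E.
have h1 : 0 < 1 + h by rewrite addr_gt0.
pose vec (a b c : R) (i : 'I_3) := nth 0 [:: a; b; c] i.
have vecP (P : R -> Prop) (a b c : R) : P a -> P b -> P c -> forall i, P (vec a b c i).
  by move=> Pa Pb Pc [[|[|[|i]]] Hi].
(* The weights average the first coordinates to 1 for any [l], and the second ones to 1 by the
   equation for [u2 - 1]. The relation is the cross product of the two coordinate vectors; its sum
   is minus the collinearity defect. *)
have := @two_block_relation_sum0 (h / (1 + h)) 'I_3 (vec s 1 t) (vec u1 u2 u3)
  (nu / (1 + h)) (vec (l * (t - 1)) (1 - l * (t - s)) (l * (1 - s)))
  (vec (1 * u3 - t * u2) (t * u1 - s * u3) (s * u2 - 1 * u1)).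
rewrite !big_ord_recl !big_ord0 /vec/= => H.
apply/oppr_inj; rewrite oppr0 -[RHS]H => {H}.
- by ring.
- by rewrite divr_gt0// ltr_pdivrMr// mul1r ltrDr ltr01.
- by move=> i; apply: (vecP (fun x => 0 < x)) => //; exact: lt_trans t1.
- by move=> i; apply: (vecP (fun x => 0 < x)).
- by move=> [[|[|[|i]]] Hi] //=; rewrite ?fu1 ?fu2 ?fu3; field; exact: lt0r_neq0.
- move=> i; apply: (vecP (fun x => 0 < x)); [|by rewrite subr_gt0|];
    by rewrite mulr_gt0// subr_gt0.
- by ring.
- by ring.
- by move: u2E; rewrite mulrBr mulrBr; lra.
- by ring.
- by ring.
Qed.

(* Otherwise, for small h > 0 and this choice of eta, the points (s, u1), (1, u2),
   (t, u3) with u2 = 1 + eta * h are not collinear and have (1, 1) in the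
   interior of their convex hull. *)
Lemma conjugate_at_slope_collinear (s t : R) : 0 < s < 1 -> 1 < t ->
  (t - 1) * f s + (1 - s) * f t = 0.
Proof.
move=> s01 t1; apply/eqP/negPn/negP => K0; set K := (X in X != 0) in K0.
have /andP[s0 s1] := s01.
have ts0 : 0 < t - s by lra.
pose d := 1 * derive1 D 1.
have d0 : 0 < d by rewrite /d mul1r; exact: derive1_slope_gt0.
have df : is_derive (1 : R) 1 f d by exact: is_derive_conjugate_at_slope.
(* The default value 1 keeps [inv] positive even outside the range of [f]. *)
pose inv (y : R) : R := xget 1 [set u : R | 0 < u /\ f u = y].
have inv_gt0 y : 0 < inv y by rewrite /inv; case: xgetP => // u _ [].
have finv u : 0 < u -> inv (f u) = u.
  move=> u0; apply: xget_unique => // v [v0 fvu].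
  case: (ltgtP v u) => // vu; [have := conjugate_at_slope_lt phi_smooth phi_C3 v0 vu
    |have := conjugate_at_slope_lt phi_smooth phi_C3 u0 vu]; by rewrite -/f fvu ltxx.
have near_pos : \forall u \near (1 : R), 0 < u by exact: lt_nbhsr.
have fK : {near (1 : R), cancel f inv} by apply: filterS near_pos => u; exact: finv.
have fcont : {near (1 : R), continuous f}.
  apply: filterS near_pos => u u0; apply: (@is_derive_continuous _ f).
  exact: is_derive_conjugate_at_slope.
have [_ invK] := near_can_continuousAcan_sym fK fcont.
have dinv := is_derive_inverse fK fcont df (lt0r_neq0 d0).
(* The defect [E h] has derivative [K / d] at 0, whatever [eta] is. This [eta] makes l = eta h /
   E(h) tend to half of its upper bound 1 / (t - s). *)
pose eta := K / (2 * (t - s) * d).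
(* The level set through [(1, 1 + eta * h)] requires the value [a c h] of [f] at the second
   coordinate when [f] equals [c] at the first, because [f 1 = 0]. *)
pose a (c h : R) := f (1 + eta * h) - h * c.
have a0 c : a c 0 = f 1 by rewrite /a mulr0 addr0 mul0r subr0.
have da c : is_derive (0 : R) 1 (a c) (d * eta - c).
  have dlin : is_derive (0 : R) 1 (cst 1 + cst eta * id : R -> R) eta.
    apply: is_derive_eq; rewrite /GRing.scale/=; ring.
  have df' : is_derive ((cst 1 + cst eta * id : R -> R) 0) 1 f d.
    by rewrite (_ : (cst 1 + cst eta * id : R -> R) 0 = 1 + eta * 0)// mulr0 addr0.
  have -> : a c = (f \o (cst 1 + cst eta * id : R -> R)) - id * cst c.
    by apply/funext.
  apply: is_derive_eq; rewrite /GRing.scale/=; ring.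
pose u c := inv \o a c.
have du c : is_derive (0 : R) 1 (u c) (d^-1 * (d * eta - c)).
  by apply: is_derive1_comp; rewrite a0.
pose E (h : R) := (t - s) * (1 + eta * h) - (t - 1) * u (f s) h - (1 - s) * u (f t) h.
have dE : is_derive (0 : R) 1 E (K / d).
  have -> : E = cst (t - s) * (cst 1 + cst eta * id) -
      cst (t - 1) * u (f s) - cst (1 - s) * u (f t).
    by apply/funext.
  apply: is_derive_eq; rewrite /GRing.scale/= /eta /K.
  by field; rewrite !lt0r_neq0.
have E0 : E 0 = 0 by rewrite /E /u /= !a0 finv//; ring.
have Elim : (E h / h) @[h --> 0^'+] --> K / d.
  have [dE1 dE2] := dE.
  have : h^-1 *: ((E \o shift 0) (h *: (1 : R)) - E 0) @[h --> (0 : R)^'] --> K / d.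
    by rewrite -dE2; exact: dE1.
  move/cvg_dnbhs_at_right; apply: cvg_trans; apply: near_eq_cvg; near=> h.
  by rewrite /= E0 subr0 addr0 [h *: 1]mulr1 /GRing.scale/= mulrC.
have llim : (eta / (E h / h)) @[h --> 0^'+] --> eta / (K / d).
  apply: cvgM; first exact: cvg_cst.
  by apply: cvgV => //; rewrite mulf_neq0// invr_eq0 lt0r_neq0.
have inv_near c : \forall h \near 0^'+, f (u c h) = a c h.
  have ac : a c h @[h --> (0 : R)] --> f 1.
    by rewrite -(a0 c); exact: (is_derive_continuous (da c)).
  exact: (cvg_at_right_filter ac invK).
have lE : eta / (K / d) = (2 * (t - s))^-1.
  rewrite /eta; move: (K) K0 => k k0; field.
  by rewrite k0 !lt0r_neq0.
have near_l0 : \forall h \near 0^'+, 0 < eta / (E h / h).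
  by apply: (cvgr_gt _ llim); rewrite lE invr_gt0 mulr_gt0.
have near_l1 : \forall h \near 0^'+, eta / (E h / h) < (t - s)^-1.
  by apply: (cvgr_lt _ llim); rewrite lE ltf_pV2 ?posrE ?mulr_gt0//; lra.
have near_u2 : \forall h \near 0^'+, 0 < 1 + eta * h.
  have : 1 + eta * h @[h --> (0 : R)] --> 1 + eta * 0.
    by apply: cvgD; [exact: cvg_cst|apply: cvgM; [exact: cvg_cst|exact: cvg_id]].
  rewrite mulr0 addr0 => /cvg_at_right_filter u2lim.
  by apply: (cvgr_gt _ u2lim).
near (0 : R)^'+ => h.
have h0 : 0 < h by [].
have l0 : 0 < eta / (E h / h) by near: h.
have l1 : eta / (E h / h) < (t - s)^-1 by near: h.
(* Division by zero yields 0, which contradicts the positivity of [l]. *)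
have Eh0 : E h / h != 0.
  by apply/eqP => Eh; move: l0; rewrite Eh invr0 mulr0 ltxx.
have := three_points_collinear s01 t1 (inv_gt0 (a (f s) h)) _ (inv_gt0 (a (f t) h)) h0.
move=> /(_ (1 + eta * h) (f (1 + eta * h)) (eta / (E h / h))).
have -> : (t - s) * (1 + eta * h) - (t - 1) * inv (a (f s) h)
  - (1 - s) * inv (a (f t) h) = E h by [].
move=> EhE; have := Eh0; rewrite {}EhE ?mul0r ?eqxx//.
- by near: h.
- by near: h; exact: inv_near.
- by rewrite /f conjugate_at_slope1// mulr0 subr0.
- by near: h; exact: inv_near.
- by rewrite -ltr_pdivlMr// div1r.
- have Eh : E h != 0 by apply: contraNneq Eh0 => ->; rewrite mul0r.
  move: (E h) Eh => e e0; field.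
  by rewrite e0 lt0r_neq0.
Unshelve. all: by end_near. Qed.

Lemma conjugate_at_slope_affine : exists2 k, 0 < k & forall t : R, 0 < t -> f t = k * (t - 1).
Proof.
have f1 : f 1 = 0 by exact: conjugate_at_slope1.
have f2 : 0 < f 2.
  by rewrite -f1; apply: (conjugate_at_slope_lt phi_smooth phi_C3) => //; rewrite ltr1n.
have half01 : 0 < (2^-1 : R) < 1 by rewrite invr_gt0 ltr0n invf_lt1// ltr1n.
exists (f 2) => // t t0; case: (ltgtP t 1) => [t1|t1|->]; last by rewrite subrr mulr0.
- have := @conjugate_at_slope_collinear t 2; rewrite t0 t1 ltr1n => /(_ isT isT); lra.
(* Points to the right of 1 are compared with 2 through the common left point 1/2. *)
- have := conjugate_at_slope_collinear half01 t1.
  have := @conjugate_at_slope_collinear 2^-1 2 half01; rewrite ltr1n => /(_ isT) E2 Et.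
  have := congr1 ( *%R (t - 1)) E2.
  by nra.
Qed.

End Affine.

(** * Relative entropy *)

Section RelativeEntropy.
Context {R : realType}.

(* Junk value: ln 0 = 0, so that 0 * ln (0 / c) = 0 as required. *)
Definition entropy_term (c p : R) : R := p * ln (p / c).

Lemma entropy_termE (c p : R) : 0 < c -> 0 <= p ->
  entropy_term c p = p * ln p - p * ln c.
Proof.
move=> c0; rewrite le_eqVlt /entropy_term => /predU1P[<-|p0]; first by rewrite !mul0r subrr.
by rewrite ln_div ?posrE// mulrBr.
Qed.

(** This is 1 + v < exp v at v = ln (x / y). *)
Lemma entropy_term_tangent_lt (c x y : R) : 0 < c -> 0 < x -> 0 <= y -> y != x ->
  y * (1 + ln x - ln c) - x < entropy_term c y.
Proof.
move=> c0 x0 y0 yx; rewrite entropy_termE//; move: y0; rewrite le_eqVlt => /predU1P[<-|y0].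
  by rewrite !mul0r; lra.
have : ln (x / y) != 0.
  rewrite ln_eq0 ?divr_gt0//; apply: contraNneq yx => xy.
  by apply/eqP; rewrite -[x](divfK (lt0r_neq0 y0)) xy mul1r.
move=> /expR_gt1Dx; rewrite lnK ?posrE ?divr_gt0// ln_div ?posrE//.
by rewrite ltr_pdivlMr//; lra.
Qed.

Lemma entropy_term_tangent_le (c x y : R) : 0 < c -> 0 < x -> 0 <= y ->
  y * (1 + ln x - ln c) - x <= entropy_term c y.
Proof.
move=> c0 x0 y0; case: (eqVneq y x) => [->|yx]; last exact/ltW/entropy_term_tangent_lt.
by rewrite (entropy_termE c0 (ltW x0)); lra.
Qed.

Lemma entropy_term_tangent_eq (c z t x y : R) : 0 < c -> 0 < z ->
  z = t * x + (1 - t) * y ->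
  entropy_term c z = t * (x * (1 + ln z - ln c) - z) + (1 - t) * (y * (1 + ln z - ln c) - z).
Proof.
move=> c0 z0 zE; rewrite (entropy_termE c0 (ltW z0)).
have : z * (1 + ln z - ln c) = (t * x + (1 - t) * y) * (1 + ln z - ln c) by rewrite -zE.
lra.
Qed.

Lemma entropy_term_convex (c x y t : R) : 0 < c -> 0 <= x -> 0 <= y -> 0 <= t <= 1 ->
  entropy_term c (t * x + (1 - t) * y) <= t * entropy_term c x + (1 - t) * entropy_term c y.
Proof.
move=> c0 x0 y0 /andP[t0 t1]; have t1' : 0 <= 1 - t by rewrite subr_ge0.
set z := t * x + _.
have : 0 <= z by rewrite addr_ge0 ?mulr_ge0.
rewrite le_eqVlt => /predU1P[z0|z0].
  have tx : t * x = 0 by have := mulr_ge0 t0 x0; have := mulr_ge0 t1' y0; rewrite /z in z0; lra.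
  have ty : (1 - t) * y = 0 by rewrite /z in z0; lra.
  by rewrite -z0 /entropy_term !mulrA tx ty !mul0r addr0.
rewrite (entropy_term_tangent_eq c0 z0 (erefl z)).
by apply: lerD; apply: ler_wpM2l => //; exact: entropy_term_tangent_le.
Qed.

Lemma entropy_term_strictly_convex (c x y t : R) :
  0 < c -> 0 <= x -> 0 <= y -> x != y -> 0 < t < 1 ->
  entropy_term c (t * x + (1 - t) * y) < t * entropy_term c x + (1 - t) * entropy_term c y.
Proof.
move=> c0 x0 y0 xy /andP[t0 t1]; have t1' : 0 < 1 - t by rewrite subr_gt0.
set z := t * x + _.
have z0 : 0 < z.
  have tx0 := mulr_ge0 (ltW t0) x0; have ty0 := mulr_ge0 (ltW t1') y0.
  rewrite lt_neqAle /z addr_ge0// andbT eq_sym; apply: contra xy => /eqP z0.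
  have /eqP : t * x = 0 by lra.
  have /eqP : (1 - t) * y = 0 by lra.
  by rewrite !mulf_eq0 (gt_eqF t0) (gt_eqF t1')/= => /eqP -> /eqP ->.
have xz : x != z.
  rewrite -subr_eq0 (_ : x - z = (1 - t) * (x - y)); last by rewrite /z; ring.
  by apply: mulf_neq0; [exact: lt0r_neq0|rewrite subr_eq0].
rewrite (entropy_term_tangent_eq c0 z0 (erefl z)); apply: ltr_leD.
  by rewrite ltr_pM2l//; exact: entropy_term_tangent_lt.
by rewrite ler_pM2l//; exact: entropy_term_tangent_le.
Qed.

Lemma entropy_term_lsc (c x e : R) : 0 < c -> 0 <= x -> 0 < e ->
  \forall y \near x, 0 <= y -> entropy_term c x - e < entropy_term c y.
Proof.
move=> c0 x0 e0.
have [z z0 Lx] : exists2 z, 0 < z &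
    entropy_term c x - e < x * (1 + ln z - ln c) - z.
  (* At [x = 0] the slope is infinite; the tangent at [e / 2] is used instead, whose value at 0 is
     [- e / 2]. *)
  move: x0; rewrite le_eqVlt => /predU1P[<-|x0].
    by exists (e / 2); [rewrite divr_gt0|rewrite /entropy_term !mul0r; lra].
  by exists x => //; rewrite entropy_termE ?ltW//; lra.
have Lcvg : y * (1 + ln z - ln c) - z @[y --> x] --> x * (1 + ln z - ln c) - z.
  by apply: cvgB; [apply: cvgM; [exact: cvg_id|exact: cvg_cst]|exact: cvg_cst].
apply: filterS (cvgr_gt _ Lcvg _ Lx) => y Ly y0.
exact: (lt_le_trans Ly (entropy_term_tangent_le c0 z0 y0)).
Qed.

Context {Theta : finType} (k : R).
Hypothesis k_gt0 : 0 < k.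

Definition relative_entropy (pi p : Theta -> R) : \bar R :=
  (k * \sum_th entropy_term (pi th) (p th))%:E.

Lemma posterior_family_relative_entropy : posterior_family relative_entropy.
Proof.
split=> pi [[pi_ge0 pi1] pi0].
- move=> p [p0 p1]; rewrite lee_fin mulr_ge0 ?(ltW k_gt0)//.
  suff : \sum_th (p th - pi th) <= \sum_th entropy_term (pi th) (p th).
    by rewrite sumrB p1 pi1 subrr.
  apply: ler_sum => th _; have := entropy_term_tangent_le (pi0 th) (pi0 th) (p0 th); lra.
- move=> p q t [p0 _] [q0 _] t01; rewrite -!EFinM -EFinD lee_fin.
  rewrite mulrCA [X in _ <= _ + X]mulrCA -mulrDr ler_pM2l//.
  rewrite !mulr_sumr -big_split/=; apply: ler_sum => th _.
  exact: entropy_term_convex.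
- move=> p a ap; have [pS|pS] := pselect (simplex (p : Theta -> R)); last first.
    exists [set p]; last by move=> y ->.
    by rewrite /nbhs/= -nbhs_subspace_out// => y ->.
  exists [set y | (a%:E < relative_entropy pi y)%E] => //.
  rewrite /nbhs/= -nbhs_subspace_in//.
  have [p0 _] := pS.
  (* With [N] above the number of states, the losses [e] over all states use up less than the gap
     [h - a]. *)
  pose N : R := #|Theta|%:R + 1.
  have N0 : 0 < N by rewrite ltr_wpDl.
  rewrite /relative_entropy lte_fin in ap; set h := (X in a < X) in ap.
  pose e := (h - a) / (k * N).
  have e0 : 0 < e by rewrite divr_gt0 ?mulr_gt0// subr_gt0.
  have near_th th : \forall y \near (p : {ptws Theta -> R}), 0 <= y th ->
      entropy_term (pi th) (p th) - e < entropy_term (pi th) (y th).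
    have := @proj_continuous Theta (fun=> R) th p.
    by move=> /(_ _ (entropy_term_lsc (pi0 th) (p0 th) e0)).
  apply: filterS (filter_forall (nbhs_filter (p : {ptws Theta -> R})) near_th) => y yp [y0 _].
  rewrite /= lte_fin.
  have : \sum_th (entropy_term (pi th) (p th) - e) <= \sum_th entropy_term (pi th) (y th).
    by apply: ler_sum => th _; apply: ltW; exact: yp.
  rewrite sumrB sumr_const -mulr_natr => /(ler_wpM2l (ltW k_gt0)).
  apply: lt_le_trans; rewrite mulrBr -/h.
  have -> : k * (e * #|Theta|%:R) = (h - a) * (#|Theta|%:R / N).
    by rewrite /e; field; rewrite !gt_eqF.
  have N1 : 0 < 1 - #|Theta|%:R / N by rewrite subr_gt0 ltr_pdivrMr// mul1r ltrDl.
  have ha : 0 < h - a by rewrite subr_gt0.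
  by have := mulr_gt0 ha N1; lra.
- rewrite /relative_entropy big1 ?mulr0// => th _.
  by rewrite /entropy_term divff ?gt_eqF// ln1 mulr0.
- move=> p q t [[p0 _] _] [[q0 _] _] pq t01; rewrite -!EFinM -EFinD lte_fin.
  rewrite mulrCA [X in _ < _ + X]mulrCA -mulrDr ltr_pM2l//.
  have [th /eqP pqth] : exists th, p th <> q th.
    by apply/existsNP => pqE; apply: pq; exact/funext.
  rewrite !mulr_sumr -big_split/= (bigD1 th)//= [ltRHS](bigD1 th)//=.
  apply: ltr_leD; first exact: entropy_term_strictly_convex.
  have /andP[t0 t1] := t01.
  by apply: ler_sum => th' _; apply: entropy_term_convex => //; rewrite !ltW.
- split; first by split=> //; rewrite ltey.
  (* Near [pi] all coordinates are positive, and affine combinations keep the total mass 1. *)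
  have near_th th : \forall y \near (pi : {ptws Theta -> R}), 0 < y th.
    have := @proj_continuous Theta (fun=> R) th pi.
    by move=> /(_ _ (lt_nbhsr (pi0 th))).
  apply: filterS (filter_forall (nbhs_filter (pi : {ptws Theta -> R})) near_th).
  move=> y y0 [n [w [z [zC w1 yE]]]].
  split; last by rewrite ltey.
  split=> [th|]; first exact: ltW.
  have -> : \sum_th y th = \sum_i w i * \sum_th z i th.
    under [RHS]eq_bigr => i _ do rewrite mulr_sumr.
    rewrite exchange_big/=; apply: eq_bigr => th _; rewrite yE fct_sumE.
    by apply: eq_bigr.
  by rewrite -[RHS]w1; apply: eq_bigr => i _; rewrite (zC i).1.2 mulr1.
Qed.

End RelativeEntropy.

(** * Mutual information *)

Section MutualInformation.
Context {R : realType} {Theta : finType}.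

Lemma marginal_eq0 (S : finType) (P : Theta -> S -> R) (pi : Theta -> R) s :
  experiment P -> full_support_prior pi -> marginal P pi s = 0 -> forall th, P th s = 0.
Proof.
move=> Pexp [_ pi0] /eqP m0 th.
have := m0; rewrite psumr_eq0 => [/allP/(_ th (mem_index_enum _))|th' _].
  by rewrite mulf_eq0 gt_eqF//= => /eqP.
by rewrite mulr_ge0 ?(Pexp th').1// ltW.
Qed.

Lemma simplex_marginal (S : finType) (P : Theta -> S -> R) (pi : Theta -> R) :
  experiment P -> full_support_prior pi -> simplex (marginal P pi).
Proof.
move=> Pexp [[pi_ge0 pi1] _]; split=> [s|].
  by apply: sumr_ge0 => th _; rewrite mulr_ge0 ?(Pexp th).1.
rewrite /marginal exchange_big -[RHS]pi1 /=; apply: eq_bigr => th _.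
by rewrite -mulr_sumr (Pexp th).2 mulr1.
Qed.

(** The infinite branch of the divergence never occurs: a null marginal forces [P th s = 0] in every
    state. *)
Lemma mutual_informationE (S : finType) (P : Theta -> S -> R) (pi : Theta -> R) :
  experiment P -> full_support_prior pi ->
  mutual_information S P pi =
  (\sum_s \sum_th pi th * entropy_term (marginal P pi s) (P th s))%:E.
Proof.
move=> Pexp pi_full; rewrite exchange_big/= -sumEFin; apply: eq_bigr => th _.
rewrite -mulr_sumr EFinM -sumEFin; congr (_ * _)%E; apply: eq_bigr => s _.
rewrite /entropy_term; case: eqP => [->|/eqP P0]; first by rewrite mul0r.
case: eqP => // m0; by move: P0; rewrite (marginal_eq0 Pexp pi_full m0) eqxx.
Qed.

Lemma relative_entropy_cost (k : R) (S : finType) (P : Theta -> S -> R) (pi : Theta -> R) :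
  experiment P -> full_support_prior pi ->
  posterior_separable_cost (relative_entropy k) S P pi = (k%:E * mutual_information S P pi)%E.
Proof.
move=> Pexp pi_full; rewrite mutual_informationE// -EFinM /posterior_separable_cost.
under eq_bigr => s _ do rewrite /relative_entropy -EFinM.
rewrite sumEFin; congr (_%:E); rewrite mulr_sumr big_mkcond; apply: eq_bigr => s _.
case: ltP => m0; last first.
  rewrite big1 ?mulr0// => th _.
  rewrite /entropy_term (marginal_eq0 Pexp pi_full) ?mul0r ?mulr0//.
  by apply/eqP; rewrite eq_le m0 (simplex_marginal Pexp pi_full).1.
rewrite mulrCA; congr (_ * _); rewrite mulr_sumr; apply: eq_bigr => th _.
rewrite /entropy_term /posterior.
have -> : pi th * P th s / marginal P pi s / pi th = P th s / marginal P pi s.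
  by have := pi_full.2 th => pi0; field; rewrite !gt_eqF.
by field; rewrite gt_eqF.
Qed.

(** * Csiszar cost of the Kullback-Leibler transformation *)

Section KullbackLeibler.
Context (phi : R -> \bar R) (k : R).
Hypothesis phi_tr : transformation phi.
Hypothesis phi_smooth : essentially_smooth phi.
Hypothesis phi_C3 : C3_pos_deriv2 phi.
Hypothesis k_gt0 : 0 < k.
Hypothesis phi_affine : forall t : R, 0 < t -> conjugate_at_slope phi t = k * (t - 1).

(* [t phi' - phi = k (t - 1)] says that [phi / t - k (ln t + 1 / t)] has zero derivative. *)
Lemma kl_transformationE (t : R) : 0 < t -> fine (phi t) = k * (t * ln t - t + 1).
Proof.
pose g (x : R) := fine (phi x) / x - k * (ln x + x^-1).
have dg (x : R) : 0 < x -> is_derive x 1 g 0.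
  move=> x0; have dphi := is_derive_transformation phi_smooth x0.
  have dln := is_derive1_ln x0.
  have dinv : is_derive x 1 (fun y : R => y^-1) (- x ^- 2).
    by apply: is_derive_eq (is_deriveV (lt0r_neq0 x0) (is_derive_id x 1)) _; exact: mulr1.
  have -> : g = (fine \o phi) * (fun y => y^-1) - cst k * (@ln R + (fun y => y^-1)).
    by apply/funext.
  have := phi_affine x0; rewrite /conjugate_at_slope => E.
  apply: is_derive_eq; rewrite /GRing.scale/= -/(slope phi).
  have -> : slope phi x = (fine (phi x) + k * (x - 1)) / x.
    by rewrite -E subrKC mulrC mulKf// gt_eqF.
  by field; rewrite gt_eqF.
have g1 : g 1 = - k by rewrite /g (transformation_at1 phi_tr) ln1 invr1 /=; ring.
have gE (x : R) : 0 < x -> g x = - k.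
  move=> x0; rewrite -g1; case: (ltgtP x 1) => [x1|x1|->//].
    by have [c _] := derive_MVT x0 x1 dg; rewrite mul0r => /subr0_eq.
  by have [c _] := derive_MVT ltr01 x1 dg; rewrite mul0r => /subr0_eq.
move=> t0; have := gE _ t0; rewrite /g => /(congr1 ( *%R t)).
have -> : t * (fine (phi t) / t - k * (ln t + t^-1)) = fine (phi t) - k * (t * ln t + 1).
  by field; rewrite gt_eqF.
by lra.
Qed.

(** Lower semicontinuity bounds [phi 0] by the limit [k] from the right, since [phi y < k] for
    [0 < y < 1]. Conversely, the tangent at [x] takes the value [k - k * x] at 0, which exceeds any
    [r < k] for small [x]. *)
Lemma kl_transformation0 : phi 0 = k%:E.
Proof.
apply/eqP; rewrite eq_le; apply/andP; split.
  rewrite leNgt; apply/negP => phi0k.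
  have [V] := transformation_lsc phi_tr (x := (0 : R)) phi0k.
  rewrite /nbhs/= -nbhs_subspace_in/=; last exact: lexx.
  move=> V0 phiV.
  have near0 : \forall y \near (0 : R)^'+, (k%:E < phi y)%E.
    have nearV : \forall y \near (0 : R)^'+, 0 <= y -> V y.
      by exact: (cvg_at_right_filter (@cvg_id _ (nbhs (0 : R))) V0).
    near=> y; apply: phiV; suff yV : 0 <= y -> V y by apply: yV; exact: ltW.
    by near: y.
  near (0 : R)^'+ => y.
  have y0 : 0 < y by [].
  have y1 : y < 1 by near: y; exact: nbhs_right_lt.
  have : (k%:E < phi y)%E by near: y.
  rewrite (transformation_EFin phi_smooth y0) kl_transformationE// lte_fin.
  have lny : ln y < 0 by rewrite ln_lt0// y0.
  have := mulr_gt0 k_gt0 (mulr_gt0 y0 (_ : 0 < 1 - ln y)).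
  by rewrite subr_gt0 (lt_trans lny)// => /(_ isT); lra.
rewrite leNgt; apply/negP => phi0k.
have := transformation_ge0 phi_tr (lexx 0).
case E : (phi 0) phi0k => [r| |] //; rewrite lte_fin lee_fin => rk r0.
pose x := (1 - r / k) / 2.
have rk1 : r / k < 1 by rewrite ltr_pdivrMr// mul1r.
have x0 : 0 < x by rewrite divr_gt0// subr_gt0.
have := transformation_ge_tangent phi_tr phi_smooth phi_C3 x0 (lexx 0).
rewrite E lee_fin phi_affine// mul0r.
have kx : k * x = (k - r) / 2 by rewrite /x; field; rewrite gt_eqF.
by rewrite mulrBr kx; lra.
Unshelve. all: by end_near. Qed.

Lemma kl_slopeE (t : R) : 0 < t -> slope phi t = k * ln t.
Proof.
move=> t0; have := phi_affine t0; rewrite /conjugate_at_slope kl_transformationE// => E.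
by apply: (mulfI (lt0r_neq0 t0)); lra.
Qed.

(** The tangent point [p / m] is the likelihood ratio for the reference [m]. When [m] is the
    marginal, averaging over states cancels the two terms in [b]. *)
Lemma kl_perspective_ge (p m b : R) : 0 <= p -> 0 < m -> 0 <= b ->
  ((k * (entropy_term m p - b * (p / m) + b))%:E <= perspective phi p b)%E.
Proof.
move=> + m0 b0; rewrite le_eqVlt => /predU1P[<-|p0].
  rewrite /entropy_term !mul0r mulr0 subr0 add0r.
  move: b0; rewrite le_eqVlt => /predU1P[<-|b0].
    by rewrite (perspective00 phi_tr) mulr0.
  by rewrite /perspective gt_eqF// mul0r kl_transformation0 -EFinM mulrC.
have pm0 : 0 < p / m by rewrite divr_gt0.
have := perspective_ge_tangent phi_tr phi_smooth phi_C3 pm0 (ltW p0) b0.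
apply: le_trans; rewrite lee_fin kl_slopeE// phi_affine// /entropy_term.
by rewrite le_eqVlt; apply/orP; left; apply/eqP; ring.
Qed.

Lemma kl_perspective (p m : R) : 0 <= p -> 0 < m ->
  perspective phi p m = (k * (entropy_term m p - p + m))%:E.
Proof.
move=> + m0; rewrite /perspective gt_eqF// le_eqVlt => /predU1P[<-|p0].
  by rewrite /entropy_term !mul0r subr0 add0r kl_transformation0 -EFinM mulrC.
have pm0 : 0 < p / m by rewrite divr_gt0.
rewrite (transformation_EFin phi_smooth pm0) kl_transformationE// -EFinM.
by congr (_%:E); rewrite /entropy_term; field; rewrite gt_eqF.
Qed.

(** The marginal is an optimal reference distribution: it yields the upper bound, and the tangent
    bound at its likelihood ratios is the same for every [b]. *)
Lemma kl_csiszar_cost (S : finType) (P : Theta -> S -> R) (pi : Theta -> R) :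
  experiment P -> full_support_prior pi ->
  csiszar_cost phi S P pi = (k%:E * mutual_information S P pi)%E.
Proof.
move=> Pexp pi_full; rewrite mutual_informationE// -EFinM.
have mS := simplex_marginal Pexp pi_full.
have sum_perspective (b : S -> R) : simplex b ->
    (\sum_th (pi th)%:E * \sum_s perspective phi (P th s) (b s) =
     \sum_s \sum_th (pi th)%:E * perspective phi (P th s) (b s))%E.
  move=> bS; rewrite exchange_big/=; apply: eq_bigr => th _.
  rewrite ge0_sume_distrr// => s _.
  by apply: perspective_ge0 => //; [exact: (Pexp th).1|exact: bS.1].
have m_gt0 s : marginal P pi s != 0 -> 0 < marginal P pi s.
  by move=> m0; rewrite lt_neqAle eq_sym m0 mS.1.
apply/eqP; rewrite eq_le; apply/andP; split.
  apply: ge_ereal_inf; eexists; first by exists (marginal P pi).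
  rewrite sum_perspective// mulr_sumr -sumEFin; apply: lee_sum => s _.
  have [m0|/m_gt0 m0] := eqVneq (marginal P pi s) 0.
    rewrite m0 !big1 ?mulr0// => th _; rewrite (marginal_eq0 Pexp pi_full m0).
      by rewrite /entropy_term mul0r mulr0.
    by rewrite (perspective00 phi_tr) mule0.
  rewrite (eq_bigr (fun th => (pi th * (k * (entropy_term (marginal P pi s) (P th s)
    - P th s + marginal P pi s)))%:E)); last first.
    by move=> th _; rewrite kl_perspective// (Pexp th).1.
  rewrite sumEFin lee_fin.
  rewrite (eq_bigr (fun th => k * (pi th * entropy_term (marginal P pi s) (P th s)) +
     (k * marginal P pi s * pi th - k * (pi th * P th s)))); last by move=> th _; ring.
  rewrite big_split/= sumrB -!mulr_sumr pi_full.1.2 mulr1.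
  by rewrite [\sum_i _ * P _ _]/(marginal P pi s) subrr addr0.
apply/ereal_infP => _ [b bS <-]; rewrite sum_perspective// mulr_sumr -sumEFin.
apply: lee_sum => s _; have [m0|/m_gt0 m0] := eqVneq (marginal P pi s) 0.
  rewrite [X in (X%:E <= _)%E](_ : _ = 0); last first.
    rewrite big1 ?mulr0// => th _.
    by rewrite /entropy_term (marginal_eq0 Pexp pi_full m0) mul0r mulr0.
  apply: sume_ge0 => th _; rewrite mule_ge0 ?lee_fin ?(ltW (pi_full.2 th))//.
  by apply: perspective_ge0 => //; [exact: (Pexp th).1|exact: bS.1].
apply: (@le_trans _ _ (\sum_th (pi th * (k * (entropy_term (marginal P pi s) (P th s)
  - b s * (P th s / marginal P pi s) + b s)))%:E)%E); last first.
  apply: lee_sum => th _; rewrite EFinM; apply: lee_wpmul2l.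
    by rewrite lee_fin ltW ?pi_full.2.
  by apply: kl_perspective_ge => //; [exact: (Pexp th).1|exact: bS.1].
rewrite sumEFin lee_fin.
rewrite [leRHS](eq_bigr (fun th => k * (pi th * entropy_term (marginal P pi s) (P th s)) +
   (k * b s * pi th - k * b s / marginal P pi s * (pi th * P th s)))); last first.
  by move=> th _; field; exact: lt0r_neq0.
rewrite big_split/= sumrB -!mulr_sumr pi_full.1.2 mulr1.
rewrite [\sum_i _ * P _ _]/(marginal P pi s).
by rewrite divfK ?gt_eqF// subrr addr0.
Qed.

End KullbackLeibler.
End MutualInformation.

Theorem proposition1 (R : realType) (Theta : finType) (phi : R -> \bar R) :
  (3 <= #|Theta|)%N ->
  transformation phi -> essentially_smooth phi -> C3_pos_deriv2 phi ->
  ((forall (pi : Theta -> R) (A : {fset {ffun Theta -> R}}),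
      full_support_prior pi -> A != fset0 ->
      exists2 H : (Theta -> R) -> (Theta -> R) -> \bar R,
        posterior_family H &
        optimal_rules (posterior_separable_cost H) pi A
          = optimal_rules (csiszar_cost phi) pi A)
   <->
   (exists2 kappa : R, 0 < kappa &
      forall (S : finType) (P : Theta -> S -> R) (pi : Theta -> R),
        experiment P -> full_support_prior pi ->
        csiszar_cost phi S P pi
          = (kappa%:E * mutual_information S P pi)%E)).
Proof.
move=> /ltnW Theta_gt1 phi_tr phi_smooth phi_C3; split=> [sep|[k k0 costE] pi A pi_full _].
  have [k k0 fE] := conjugate_at_slope_affine Theta_gt1 phi_tr phi_smooth phi_C3 sep.
  by exists k => // S P pi Pexp pi_full; exact: kl_csiszar_cost.
exists (relative_entropy k); first exact: posterior_family_relative_entropy.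
(* Equality of payoffs at experiments suffices, because optimality compares only these. *)
have payoffE (P : Theta -> A -> R) : experiment P ->
    net_payoff (posterior_separable_cost (relative_entropy k)) pi P =
    net_payoff (csiszar_cost phi) pi P.
  by move=> Pexp; rewrite /net_payoff relative_entropy_cost// costE.
by apply/seteqP; split=> P [Pexp Pmax]; split=> // Q Qexp;
  have := Pmax _ Qexp; rewrite !payoffE.
Qed.
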